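(* A positive real number is an admissible $c$ if and only if it is an irrational algebraic number which is the square root of a rational number (thus the admissible $c$ form a dense subset of the positive half-line). Moreover: 1. A positive real number is an admissible $V$ if and only if it is a rational number of the form $\frac{n}{m}$, where $m,n\in\mathbb{N}$ are coprime, $m\ge 2$, and $p=\frac{m^2-1}{n}$ is an integer. 2. For every admissible $V$ there is a unique admissible $c=:c(V)$ such that the pair $(V,c(V))$ is admissible. 3. For every admissible $c$, the spectrum of $c$ is a countably infinite set $\{\ldots,-V_i,\ldots,-V_1,V_1,\ldots,V_i,\ldots\}$, with $c=c(V_i)$ for every $i\in\mathbb{N}$. 4. For every admissible $c$, the spectrum $\{\ldots,-V_i,\ldots,-V_1,V_1,\ldots,V_i,\ldots\}$ of $c$ has exactly two points of accumulation, namely $-c$ and $c$ (where $c=c(V_i)$). 5. The spectra corresponding to different admissible $c$ are mutually disjoint.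
   Context: Let $T^2=\mathbb{R}^2/\mathbb{Z}^2$ with coordinates $(x,t)$ on $\mathbb{R}^2$, and let $\mathbb{N}=\{1,2,\dots\}$. A pair of real numbers $(V,c)$ with $0<|V|<c$ is called admissible if the linear map of $\mathbb{R}^2$ $$(x,t)\mapsto\left(\frac{x-Vt}{\sqrt{1-V^2/c^2}},\ \frac{t-\frac{V}{c^2}x}{\sqrt{1-V^2/c^2}}\right)$$ is the lift (covering map) of a homeomorphism of $T^2$ (called a Lorentz transformation $\phi_{V,c}$). A number $c>0$ is called admissible (light speed) if $(V,c)$ is admissible for some $V$, and a number $V$ is called admissible (relative speed) if $(V,c)$ is admissible for some $c$. For an admissible $c$, the spectrum of $c$ is the set of all $V$ (of both signs) such that $(V,c)$ is admissible. *)

(* Defs.v *)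
From HB Require Import structures.
From mathcomp Require Import all_boot all_order all_algebra.
From mathcomp Require Import generic_quotient.
From mathcomp Require Import all_classical all_reals all_analysis.

Set Implicit Arguments.
Unset Strict Implicit.
Unset Printing Implicit Defensive.

Import Order.TTheory GRing.Theory Num.Theory.
Import numFieldNormedType.Exports.

Local Open Scope quotient_scope.
Local Open Scope classical_set_scope.
Local Open Scope ring_scope.

Definition homeomorphism (S T : topologicalType) (f : S -> T) : Prop :=
  exists g : T -> S,
    [/\ cancel f g, cancel g f, continuous f & continuous g].

Section Torus.
Variable R : realType.

Definition torus_rel : rel (R * R) := fun x y =>
  (x.1 - y.1 \is a Num.int) && (x.2 - y.2 \is a Num.int).

Lemma torus_rel_refl : reflexive torus_rel.
Proof. by move=> x; rewrite /torus_rel !subrr !rpred0. Qed.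

Lemma torus_rel_sym : symmetric torus_rel.
Proof.
by move=> x y; rewrite /torus_rel -(opprB y.1) -(opprB y.2) !rpredN.
Qed.

Lemma torus_rel_trans : transitive torus_rel.
Proof.
move=> y x z /andP[xy1 xy2] /andP[yz1 yz2]; apply/andP; split.
- by rewrite -(subrKA y.1); exact: rpredD.
- by rewrite -(subrKA y.2); exact: rpredD.
Qed.

Canonical torus_equiv :=
  EquivRel torus_rel torus_rel_refl torus_rel_sym torus_rel_trans.

Definition torus : topologicalType :=
  quotient_topology {eq_quot torus_equiv}.

Definition torus_proj : R * R -> torus := \pi_{eq_quot torus_equiv}.

Definition is_lift (L : R * R -> R * R) (f : torus -> torus) : Prop :=
  forall z, torus_proj (L z) = f (torus_proj z).

End Torus.

Section Lorentz.
Variable R : realType.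
Implicit Types V c : R.

Definition lorentz_map V c (z : R * R) : R * R :=
  let s := Num.sqrt (1 - V ^+ 2 / c ^+ 2) in
  ((z.1 - V * z.2) / s, (z.2 - V / c ^+ 2 * z.1) / s).

Definition admissible V c : Prop :=
  0 < `|V| < c /\
  exists2 f : torus R -> torus R,
    homeomorphism f & is_lift (lorentz_map V c) f.

Definition admissible_light_speed c : Prop :=
  0 < c /\ exists V, admissible V c.

Definition admissible_relative_speed V : Prop := exists c, admissible V c.

Definition spectrum c : set R := [set V | admissible V c].

(* Defaults to 0 if there is no such c; meaningful when it is unique. *)
Definition light_speed_of V : R :=
  xget 0 [set c | admissible_light_speed c /\ admissible V c].

End Lorentz.

(* Main.v *)
Require Import Defs.
From HB Require Import structures.
From mathcomp Require Import all_boot all_order all_algebra.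
From mathcomp Require Import generic_quotient.
From mathcomp Require Import all_classical all_reals all_analysis.
From mathcomp Require Import zify ring lra.
Import Order.TTheory GRing.Theory Num.Theory.
Import numFieldNormedType.Exports.

Set Implicit Arguments.
Unset Strict Implicit.
Unset Printing Implicit Defensive.

Local Open Scope classical_set_scope.
Local Open Scope ring_scope.

(** Evaluating a lift of a torus map at the lattice vectors [(1, 0)] and
    [(0, 1)] shows that the matrix of the Lorentz map has integer entries, and
    conversely an integer matrix with an integer inverse descends to a
    homeomorphism.  With [s = sqrt (1 - V^2 / c^2)], the absolute values of the
    entries are [m = 1 / s], [n = |V| / s] and [p = |V| / (c^2 s)].  So
    admissibility amounts to the arithmetic condition of [admissibleP]: natural
    numbers with [m^2 = n p + 1], [c^2 = n / p] and [|V| = n / m].  Everything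
    else is read off from such triples.

    - [m] and [n] are coprime, so [V] determines them, then [p], then [c]
      ([admissible_uniq]).
    - [m^2 - 1] is not a square for [m > 1], and it is [n p = (p c)^2]; hence
      [c] is irrational ([triple_irrational]).
    - Conversely let [c^2 = a / b] with [c] irrational.  Then [a b] is not a
      square, and a solution of the Pell equation [x^2 = a b y^2 + 1] gives the
      triple [(x, a y, b y)] ([irrational_sqrt_triple]).
    - For a fixed [c], a triple has [V^2 = c^2 (1 - 1 / m^2)].  The
      positive speeds thus increase with [m], and accumulation can happen only
      at [c] and [-c]; it does happen because [m] is unbounded: the square of
      the matrix of a Lorentz map is again one, with [m] replaced by
      [2 m^2 - 1].

    The solvability of the Pell equation ([pell]) is obtained by a reduction
    argument for binary quadratic forms: an injective step on the finite set of
    indefinite forms of given discriminant brings [x^2 - D y^2] back to itself,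
    and the accumulated change of basis is a nontrivial automorphism of that
    form. *)

(** * Pell's equation *)

(** The triple [(a, b, c)] is the form [a x^2 + 2 b x y + c y^2] in a basis
    [(u, v)].  Given opposite signs at [u] and [v], the step replaces the basis
    vector at which the form has the same sign as at [u + v] by [u + v], which
    preserves the sign pattern (this is one step along the river of Conway's
    topograph). *)
Definition form_step (F : int * int * int) : int * int * int :=
  let: (a, b, c) := F in
  if 0 < a + 2 * b + c then (a + 2 * b + c, b + c, c)
  else (a, a + b, a + 2 * b + c).

Definition indefinite (D : int) (F : int * int * int) : Prop :=
  let: (a, b, c) := F in [/\ 0 < a, c < 0 & b ^+ 2 - a * c = D].

(** The same step on the basis itself, two vectors written in the basis where
    the form is [x^2 - D y^2]. *)
Definition basis_step (D : int) (B : int * int * (int * int)) :=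
  let: ((p, q), (r, s)) := B in
  if 0 < (p + r) ^+ 2 - D * (q + s) ^+ 2 then ((p + r, q + s), (r, s))
  else ((p, q), (p + r, q + s)).

Definition form_of (D : int) (B : int * int * (int * int)) :=
  let: ((p, q), (r, s)) := B in
  (p ^+ 2 - D * q ^+ 2, p * r - D * q * s, r ^+ 2 - D * s ^+ 2).

Lemma form_of_step D B : form_of D (basis_step D B) = form_step (form_of D B).
Proof.
case: B => -[p q] [r s] /=.
have -> : p ^+ 2 - D * q ^+ 2 + 2 * (p * r - D * q * s) + (r ^+ 2 - D * s ^+ 2)
  = (p + r) ^+ 2 - D * (q + s) ^+ 2 by ring.
by case: ifP => _ /=; congr (_, _, _); ring.
Qed.

(** The new value [a + 2 b + c] cannot vanish: it would make the discriminant
    [b^2 - a c] equal to [(a + b)^2]. *)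
Lemma indefinite_step D F : (forall k : int, k ^+ 2 != D) ->
  indefinite D F -> indefinite D (form_step F).
Proof.
move=> Dsq; case: F => -[a b] c /= [a0 c0 e]; case: ifP => /= h.
  by split => //; rewrite -e; ring.
split => //; last by rewrite -e; ring.
suff : a + 2 * b + c != 0 by lia.
apply: contraNneq (Dsq (a + b)) => h0.
rewrite -e; apply/eqP; have -> : c = - a - 2 * b by lia.
ring.
Qed.

(** The value at [u - v] tells which vector was replaced: in the new basis it is
    the value at the old [u] or at the old [v], so its sign reveals the branch,
    and each branch is invertible. *)
Lemma form_step_inj D F G :
  indefinite D F -> indefinite D G -> form_step F = form_step G -> F = G.
Proof.
case: F => -[a b] c; case: G => -[a' b'] c' /= [a0 c0 _] [a0' c0' _].
by case: ifP => h; case: ifP => h' [] ? ? ?; congr (_, _, _); lia.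
Qed.

(** As [- a c] is positive, [D] is a sum of two nonnegative terms [b^2] and
    [- a c]; so there are only finitely many forms. *)
Lemma indefinite_bounds D a b c : indefinite D (a, b, c) ->
  [/\ `|a| <= D, `|b| <= D & `|c| <= D].
Proof. by move=> [a0 c0 <-]; split; nia. Qed.

Lemma inord_shift_inj (K : nat) (a b : int) : `|a| <= K%:Z -> `|b| <= K%:Z ->
  inord (absz (a + K)) = inord (absz (b + K)) :> 'I_(K + K).+1 -> a = b.
Proof.
move=> aK bK /(congr1 val); rewrite /= !inordK; lia.
Qed.

Lemma indefinite_repeat (D : nat) (F : nat -> int * int * int) :
  (forall i, indefinite D (F i)) -> exists i j, (i < j)%N /\ F i = F j.
Proof.
move=> FD.
pose code (G : int * int * int) : 'I_(D + D).+1 * 'I_(D + D).+1 * 'I_(D + D).+1 :=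
  let: (a, b, c) := G in
  (inord (absz (a + D)), inord (absz (b + D)), inord (absz (c + D))).
have codeI i j : code (F i) = code (F j) -> F i = F j.
  have := FD i; have := FD j; case: (F i) => -[a b] c; case: (F j) => -[a' b'] c'.
  move=> /indefinite_bounds [? ? ?] /indefinite_bounds [? ? ?] [].
  by do 3 move=> /inord_shift_inj -> //.
set N := #|{: 'I_(D + D).+1 * 'I_(D + D).+1 * 'I_(D + D).+1}|.
pose f (i : 'I_N.+1) := code (F i).
have /injectivePn [i [j ij fij]] : ~~ injectiveb f.
  by apply/injectiveP => /leq_card; rewrite card_ord ltnn.
have {fij} := codeI _ _ fij; move: ij; rewrite -val_eqE /=.
by case: ltngtP => // ij _ e; [exists i, j | exists j, i].
Qed.

(** The orbit of [x^2 - D y^2] under the injective step is periodic.  If the form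
    at time [k > 0] is again [x^2 - D y^2], the first basis vector [(p, q)] has
    norm 1; it is not [(1, 0)] because the nonnegative entries of the basis grow
    at every step. *)
Lemma pell (D : nat) : (0 < D)%N -> (forall k, (k ^ 2)%N != D) ->
  exists x y : nat, (0 < y)%N /\ (x ^ 2 = D * y ^ 2 + 1)%N.
Proof.
move=> D0 Dsq.
have Dsq' (k : int) : k ^+ 2 != D%:Z.
  by apply: contraNneq (Dsq `|k|%N) => h; apply/eqP; lia.
pose B i := iter i (basis_step D) ((1, 0), (0, 1)).
pose F i := form_of D (B i).
have FS i : F i.+1 = form_step (F i) by rewrite /F /= form_of_step.
have FD i : indefinite D (F i).
  elim: i => [|i IH]; last by rewrite FS; exact: indefinite_step.
  by rewrite /F /=; split; lia.
have BP i : let: ((p, q), (r, s)) := B i in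
    [/\ 0 < p, 0 <= q, 0 <= r & 0 < s] /\
    (p * s - q * r = 1 /\ i%:Z + 2 <= p + q + r + s).
  elim: i => [//|i]; rewrite /B /= -/(B i).
  by case: (B i) => -[p q] [r s] /= [[? ? ? ?] [? ?]]; case: ifP => _; repeat split; lia.
have [i [j [ij]]] := indefinite_repeat FD.
(* A repetition at times i < j is pulled back to times 0 and j - i. *)
elim: i j ij => [|i IH] [|j] // ij; last first.
  by rewrite !FS => /(form_step_inj (FD i) (FD j)); exact: IH.
move: (BP j.+1); rewrite /F; case: (B j.+1) => -[p q] [r s] /=.
move=> [[p0 q0 r0 s0] [det big]] [e1 e2 e3].
exists `|p|%N, `|q|%N; split; last by lia.
(* If q = 0 the basis has p = s = 1 and r = 0, whose sum 2 is too small. *)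
suff : q != 0 by lia.
apply/eqP => qz; move: e1 e2 e3 det big; rewrite qz => *.
have ? : p = 1 by nia.
subst p; lia.
Qed.

(** * Linear maps and homeomorphisms of the torus *)

Lemma torus_projP (R : realType) (x y : R * R) :
  torus_proj x = torus_proj y <-> torus_rel x y.
Proof.
by split=> [/(eqmodP (torus_equiv R))|h]; [|exact/(eqmodP (torus_equiv R))].
Qed.

Lemma torus_rel_vec0 (R : realType) (x y : R) :
  x \is a Num.int -> y \is a Num.int -> torus_rel (x, y) (0, 0).
Proof. by move=> xi yi; rewrite /torus_rel /= !subr0 xi yi. Qed.

(** The quotient topology makes continuity of the induced maps a statement about
    [L] and [L'], and the quotient map being onto transfers the cancellations. *)
Lemma lift_homeomorphism (R : realType) (L L' : R * R -> R * R) :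
  cancel L L' -> cancel L' L -> continuous L -> continuous L' ->
  {homo L : x y / torus_rel x y} -> {homo L' : x y / torus_rel x y} ->
  exists2 f : torus R -> torus R, homeomorphism f & is_lift L f.
Proof.
move=> LK L'K Lc L'c Lr L'r.
pose desc (M : R * R -> R * R) (t : torus R) : torus R :=
  torus_proj (M (repr (t : {eq_quot torus_equiv R}%qT))).
have descE M : {homo M : x y / torus_rel x y} -> is_lift M (desc M).
  move=> Mr z; apply/torus_projP/Mr; apply/torus_projP.
  by rewrite /torus_proj reprK.
have descC M : {homo M : x y / torus_rel x y} -> continuous M ->
    continuous (desc M).
  move=> Mr Mc; apply/quotient_continuous => x.
  have -> : desc M \o \pi_(torus R)%qT = (@torus_proj R) \o M.
    by apply/funext => z /=; rewrite descE.
  by apply: continuous_comp; [exact: Mc | exact: pi_continuous].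
have projS (t : torus R) : exists z, t = torus_proj z.
  by exists (repr (t : {eq_quot torus_equiv R}%qT)); rewrite /torus_proj reprK.
exists (desc L); last exact: descE.
exists (desc L'); split; try exact: descC.
- by move=> t; have [z ->] := projS t; rewrite -!descE // LK.
- by move=> t; have [z ->] := projS t; rewrite -!descE // L'K.
Qed.

Lemma lorentz_map_homo (R : realType) (V c : R) :
  let s := Num.sqrt (1 - V ^+ 2 / c ^+ 2) in
  s^-1 \is a Num.int -> V / s \is a Num.int -> V / c ^+ 2 / s \is a Num.int ->
  {homo lorentz_map V c : x y / torus_rel x y}.
Proof.
move=> s si Vsi Vci [x1 x2] [y1 y2] /andP[/= h1 h2].
rewrite /torus_rel /lorentz_map /= -/s; apply/andP; split.
- have -> : (x1 - V * x2) / s - (y1 - V * y2) / s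
    = (x1 - y1) * s^-1 - (x2 - y2) * (V / s) by ring.
  by apply: rpredB; apply: rpredM.
- have -> : (x2 - V / c ^+ 2 * x1) / s - (y2 - V / c ^+ 2 * y1) / s
    = (x2 - y2) * s^-1 - (x1 - y1) * (V / c ^+ 2 / s) by ring.
  by apply: rpredB; apply: rpredM.
Qed.

Lemma lorentz_map_continuous (R : realType) (V c : R) :
  continuous (lorentz_map V c).
Proof.
move=> z; rewrite /lorentz_map; set s := Num.sqrt _.
have c1 : (fst : R * R -> R) @ z --> z.1 by exact: cvg_fst.
have c2 : (snd : R * R -> R) @ z --> z.2 by exact: cvg_snd.
have l1 : (w.1 - V * w.2) / s @[w --> z] --> (z.1 - V * z.2) / s.
  by apply: cvgMr_tmp; apply: cvgB => //; exact: cvgMl_tmp.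
have l2 : (w.2 - V / c ^+ 2 * w.1) / s @[w --> z] --> (z.2 - V / c ^+ 2 * z.1) / s.
  by apply: cvgMr_tmp; apply: cvgB => //; exact: cvgMl_tmp.
exact: (cvg_pair l1 l2).
Qed.

Lemma lorentz_denominator_gt0 (R : realType) (V c : R) :
  0 < `|V| < c -> 0 < 1 - V ^+ 2 / c ^+ 2.
Proof.
move=> /andP[V0 Vc]; have c0 : 0 < c by lra.
rewrite subr_gt0 ltr_pdivrMr ?exprn_gt0 // mul1r.
by rewrite -(real_normK (num_real V)) ltr_pXn2r ?nnegrE ?ltW.
Qed.

(** The Lorentz boost of velocity [- V] undoes the one of velocity [V]; hence the
    inverse matrix has integer entries when the matrix has. *)
Lemma lorentz_mapK (R : realType) (V c : R) : 0 < `|V| < c ->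
  cancel (lorentz_map V c) (lorentz_map (- V) c).
Proof.
move=> Vc [x t]; have d0 := lorentz_denominator_gt0 Vc.
rewrite /lorentz_map /= sqrrN; set s := Num.sqrt _.
have c0' : c != 0 by case/andP: Vc => V0 Vc; lra.
have s0 : s != 0 by rewrite gt_eqF // sqrtr_gt0.
have s2 : s ^+ 2 = 1 - V ^+ 2 / c ^+ 2 by rewrite sqr_sqrtr ?ltW.
have e (u : R) : u * (1 - V ^+ 2 / c ^+ 2) / s ^+ 2 = u.
  by rewrite -s2 mulfK // expf_neq0.
by congr (_, _); [rewrite -[RHS]e | rewrite -[RHS]e]; field; rewrite s0 c0'.
Qed.

(** * Admissibility as an arithmetic condition *)

(** With [s = sqrt (1 - V^2 / c^2)], the numbers [m], [n], [p] are the absolute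
    values [1 / s], [|V| / s] and [|V| / (c^2 s)] of the matrix entries, and the quadratic equation says that the determinant is 1. *)
Definition lorentz_triple (R : realType) (c : R) (m n p : nat) : Prop :=
  [/\ (1 < m)%N, (m ^ 2 = n * p + 1)%N & c ^+ 2 * p%:R = n%:R].

(** The images of [(1, 0)] and [(0, 1)] are the columns of the matrix, and both
    lie over the image of the base point of the torus. *)
Lemma lift_entries_int (R : realType) (V c : R) : admissible V c ->
  let s := Num.sqrt (1 - V ^+ 2 / c ^+ 2) in
  [/\ s^-1 \is a Num.int, V / s \is a Num.int & V / c ^+ 2 / s \is a Num.int].
Proof.
move=> [_ [f _ fL]] s.
have lat x y : x \is a Num.int -> y \is a Num.int ->
    torus_rel (lorentz_map V c (x, y)) (0, 0).
  move=> xi yi; have -> : ((0, 0) : R * R) = lorentz_map V c (0, 0).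
    by rewrite /lorentz_map /= !mulr0 subr0 mul0r.
  by apply/torus_projP; rewrite !fL; congr f; apply/torus_projP/torus_rel_vec0.
have := lat 1 0 (rpred1 _) (rpred0 _).
have := lat 0 1 (rpred0 _) (rpred1 _).
rewrite /torus_rel /lorentz_map /= -/s !mulr0 !mulr1 !subr0 !sub0r !mul1r.
by rewrite !mulNr !rpredN => /andP[? _] /andP[? ?].
Qed.

Lemma admissible_triple (R : realType) (V c : R) : admissible V c ->
  0 < c /\ exists m n p, lorentz_triple c m n p /\ `|V| = n%:R / m%:R.
Proof.
move=> adm; have [/andP[V0 Vc] _] := adm.
have c0 : 0 < c by lra.
have [] := lift_entries_int adm; set s := Num.sqrt _.
have d0 : 0 < 1 - V ^+ 2 / c ^+ 2 by apply: lorentz_denominator_gt0; rewrite V0.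
have s0 : 0 < s by rewrite sqrtr_gt0.
have s2 : s ^+ 2 = 1 - V ^+ 2 / c ^+ 2 by rewrite sqr_sqrtr ?ltW.
move=> /natr_norm_int /natrP[m mE] /natr_norm_int /natrP[n nE].
move=> /natr_norm_int /natrP[p pE]; split=> //; exists m, n, p.
move: mE nE pE; rewrite !normrM !normfV normrX !(gtr0_norm s0) (gtr0_norm c0).
move=> mE nE pE.
have m2 : m%:R ^+ 2 = n%:R * p%:R + 1 :> R.
  rewrite -mE -nE -pE.
  have -> : `|V| / s * (`|V| / c ^+ 2 / s) = `|V| ^+ 2 / c ^+ 2 / s ^+ 2.
    by field; rewrite !gt_eqF.
  rewrite real_normK ?num_real // exprVn.
  rewrite -[1 in RHS](mulfV (_ : s ^+ 2 != 0)) ?expf_neq0 ?gt_eqF //.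
  by rewrite {3}s2; field; rewrite !gt_eqF.
split; last by rewrite -mE -nE; field; rewrite !gt_eqF.
split; last by rewrite -nE -pE; field; rewrite !gt_eqF.
  have n0 : 0 < n%:R :> R by rewrite -nE divr_gt0.
  have p0 : 0 < p%:R :> R by rewrite -pE !divr_gt0 ?exprn_gt0.
  have : 1 < m%:R ^+ 2 :> R by rewrite m2; have := mulr_gt0 n0 p0; lra.
  by rewrite -natrX ltr1n; case: (m) => [|[|]].
by apply/eqP; rewrite -(eqr_nat R) natrD natrM natrX m2.
Qed.

Lemma triple_admissible (R : realType) (V c : R) m n p : 0 < c ->
  lorentz_triple c m n p -> `|V| = n%:R / m%:R -> admissible V c.
Proof.
move=> c0 [m1 m2 cpn] VE.
have m2R : m%:R ^+ 2 = n%:R * p%:R + 1 :> R by rewrite -natrX m2 natrD natrM.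
have m0 : 0 < m%:R :> R by rewrite ltr0n; lia.
have n0 : 0 < n%:R :> R by rewrite ltr0n; nia.
have p0 : 0 < p%:R :> R by rewrite ltr0n; nia.
have V2 : V ^+ 2 = n%:R ^+ 2 / m%:R ^+ 2.
  by rewrite -(real_normK (num_real V)) VE exprMn exprVn.
have c2 : c ^+ 2 = n%:R / p%:R by rewrite -cpn mulfK // gt_eqF.
have dE : 1 - V ^+ 2 / c ^+ 2 = m%:R^-1 ^+ 2.
  rewrite V2 c2 invf_div exprVn.
  have -> : n%:R ^+ 2 / m%:R ^+ 2 * (p%:R / n%:R) = (m%:R ^+ 2 - 1) / m%:R ^+ 2 :> R.
    by rewrite m2R addrK; field; rewrite !gt_eqF.
  by field; rewrite gt_eqF.
have sE : Num.sqrt (1 - V ^+ 2 / c ^+ 2) = m%:R^-1.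
  by rewrite dE sqrtr_sqr gtr0_norm ?invr_gt0.
have bnd : 0 < `|V| < c.
  apply/andP; split; first by rewrite VE divr_gt0.
  rewrite -(@ltr_pXn2r _ 2) ?nnegrE ?normr_ge0 ?(ltW c0) // real_normK ?num_real //.
  rewrite -subr_gt0; have -> : c ^+ 2 - V ^+ 2 = c ^+ 2 * (1 - V ^+ 2 / c ^+ 2).
    by field; rewrite gt_eqF.
  by rewrite dE mulr_gt0 ?exprn_gt0 ?invr_gt0.
split=> //.
have int_norm (x : R) : `|x| \is a Num.nat -> x \is a Num.int.
  by move=> /intr_nat; case: (ger0P x) => // _; rewrite rpredN.
have homoW W : `|W| = `|V| -> {homo lorentz_map W c : x y / torus_rel x y}.
  move=> WV; have WV2 : W ^+ 2 = V ^+ 2 by rewrite -(real_normK (num_real W)) WV real_normK ?num_real.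
  apply: lorentz_map_homo; rewrite /= WV2 sE invrK.
  - by rewrite rpred_nat.
  - by apply: int_norm; rewrite normrM WV VE normr_nat divfK ?rpred_nat // gt_eqF.
  - apply: int_norm; rewrite !normrM normfV normrX WV VE normr_nat (gtr0_norm c0).
    rewrite c2 invf_div; have -> : n%:R / m%:R * (p%:R / n%:R) * m%:R = p%:R :> R.
      by field; rewrite !gt_eqF.
    by rewrite rpred_nat.
apply: (@lift_homeomorphism _ _ (lorentz_map (- V) c)).
- exact: lorentz_mapK.
- by rewrite -{2}(opprK V); apply: lorentz_mapK; rewrite normrN.
- exact: lorentz_map_continuous.
- exact: lorentz_map_continuous.
- exact: homoW.
- by apply: homoW; rewrite normrN.
Qed.

Lemma admissibleP (R : realType) (V c : R) :
  admissible V c <-> 0 < c /\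
    exists m n p, lorentz_triple c m n p /\ `|V| = n%:R / m%:R.
Proof.
split; first exact: admissible_triple.
by move=> [c0 [m [n [p [t VE]]]]]; exact: triple_admissible t VE.
Qed.

Lemma sqr_inj (R : realType) (x y : R) :
  0 <= x -> 0 <= y -> x ^+ 2 = y ^+ 2 -> x = y.
Proof. by move=> x0 y0 /eqP; rewrite eqrXn2 // => /eqP. Qed.

Lemma triple_gt0 (R : realType) (c : R) m n p :
  lorentz_triple c m n p -> [/\ (0 < m)%N, (0 < n)%N & (0 < p)%N].
Proof. by move=> [m1 e _]; split; nia. Qed.

Lemma triple_norm (R : realType) (c : R) m n p :
  lorentz_triple c m n p -> m%:R ^+ 2 = n%:R * p%:R + 1 :> R.
Proof. by move=> [_ e _]; rewrite -natrX e natrD natrM. Qed.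

Lemma triple_coprime (R : realType) (c : R) m n p :
  lorentz_triple c m n p -> coprime m n.
Proof.
move=> [_ e _]; rewrite -(coprime_pexpl _ _ (isT : 0 < 2)%N) // e /coprime mulnC.
by rewrite gcdnC gcdnMDl gcdn1.
Qed.

Lemma admissible_neg (R : realType) (V c : R) :
  admissible (- V) c <-> admissible V c.
Proof.
have imp W : admissible W c -> admissible (- W) c.
  by move=> /admissibleP[c0 h]; apply/admissibleP; rewrite normrN.
by split=> [/imp|/imp//]; rewrite opprK.
Qed.

(** * Light speeds *)

Lemma light_speedP (R : realType) (c : R) :
  admissible_light_speed c <-> 0 < c /\ exists m n p, lorentz_triple c m n p.
Proof.
split=> [[c0 [V /admissibleP[_ [m [n [p [t _]]]]]]]|[c0 [m [n [p t]]]]].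
  by split=> //; exists m, n, p.
split=> //; exists (n%:R / m%:R); apply/admissibleP; split=> //.
by exists m, n, p; rewrite ger0_norm // divr_ge0.
Qed.

Lemma pos_ratr_nat (R : realType) (q : rat) : 0 < ratr q :> R ->
  exists a b : nat, [/\ (0 < a)%N, (0 < b)%N & ratr q = a%:R / b%:R :> R].
Proof.
rewrite ltr0q => q0; exists `|numq q|%N, `|denq q|%N.
have n0 : 0 < numq q by rewrite numq_gt0.
split; [lia|have := denq_gt0 q; lia|].
by rewrite /ratr -[in LHS](gtz0_abs n0) -[in LHS](gtz0_abs (denq_gt0 q)) !pmulrn.
Qed.

Lemma nat_ratio_rational (R : realType) (a b : nat) : rational (a%:R / b%:R : R).
Proof. by exists (a%:R / b%:R) => //; rewrite fmorph_div /= !ratr_nat. Qed.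

(** If [c = x / y] then [m^2 - 1 = n p] is the square of the rational number
    [p x / y], hence of an integer [w], and [m^2 = w^2 + 1] forces [m = 1]. *)
Lemma triple_irrational (R : realType) (c : R) m n p : 0 < c ->
  lorentz_triple c m n p -> irrational c.
Proof.
move=> c0 t [q _ qc]; have [_ n0 p0] := triple_gt0 t.
have [m1 e cpn] := t.
have [x [y [x0 y0 xy]]] : exists x y : nat,
    [/\ (0 < x)%N, (0 < y)%N & c = x%:R / y%:R].
  by rewrite -qc; apply: pos_ratr_nat; rewrite qc.
have yR : y%:R != 0 :> R by rewrite pnatr_eq0; lia.
have h : (x ^ 2 * p = n * y ^ 2)%N.
  apply/eqP; rewrite -(eqr_nat R) !natrM -cpn xy; apply/eqP.
  by field.
have h2 : ((m * y) ^ 2 = (p * x) ^ 2 + y ^ 2)%N.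
  by rewrite expnMn e; nia.
have /dvdnP[w wE] : (y %| p * x)%N.
  by rewrite -(dvdn_pexp2r _ _ (k := 2)) // -(dvdn_addl _ (dvdnn _)) -h2 expnMn dvdn_mull.
have : (m ^ 2 = w ^ 2 + 1)%N.
  apply/eqP; rewrite -(eqn_pmul2r (_ : 0 < y ^ 2)%N) ?expn_gt0 ?y0 //.
  by rewrite -expnMn h2 wE expnMn mulnDl mul1n.
move=> mw; have wm : (w < m)%N by rewrite -ltn_sqr mw addn1.
have : (w.+1 ^ 2 <= m ^ 2)%N by rewrite leq_sqr.
by clear -m1 mw; rewrite mw; nia.
Qed.

(** For [c^2 = a / b] the choice [n = a y], [p = b y] gives [c^2 = n / p], and
    [m^2 = n p + 1] is the Pell equation for [a b]. *)
Lemma irrational_sqrt_triple (R : realType) (c : R) (q : rat) : 0 < c ->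
  irrational c -> c = Num.sqrt (ratr q) -> exists m n p, lorentz_triple c m n p.
Proof.
move=> c0 irr cq.
have q0 : 0 < ratr q :> R by rewrite -sqrtr_gt0 -cq.
have [a [b [a0 b0 ab]]] := pos_ratr_nat q0.
have bR : b%:R != 0 :> R by rewrite pnatr_eq0; lia.
have c2 : c ^+ 2 = a%:R / b%:R by rewrite cq sqr_sqrtr ?ltW.
have [|k|x [y [y0 xy]]] := @pell (a * b)%N; first by rewrite muln_gt0 a0.
  apply/eqP => kab; apply: irr; have -> : c = k%:R / b%:R.
    apply: sqr_inj; rewrite ?divr_ge0 ?(ltW c0) //.
    by rewrite c2 expr_div_n -natrX kab natrM; field.
  exact: nat_ratio_rational.
exists x, (a * y)%N, (b * y)%N; split; first nia.
  by rewrite xy; nia.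
by rewrite c2 !natrM; field.
Qed.

Lemma light_speed_irrationalP (R : realType) (c : R) : 0 < c ->
  admissible_light_speed c <->
  [/\ irrational c, algebraicOver (ratr : rat -> R) c
    & exists q : rat, c = Num.sqrt (ratr q)].
Proof.
move=> c0; split=> [/light_speedP[_ [m [n [p t]]]]|[irr _ [q cq]]]; last first.
  by apply/light_speedP; split=> //; exact: irrational_sqrt_triple cq.
have [_ _ cpn] := t; have [_ _ p0] := triple_gt0 t.
have pR : p%:R != 0 :> R by rewrite pnatr_eq0; lia.
have c2 : c ^+ 2 = ratr (n%:R / p%:R).
  by rewrite fmorph_div /= !ratr_nat -cpn mulfK.
split.
- exact: triple_irrational t.
- exists ('X^2 - (n%:R / p%:R)%:P); first exact/monic_neq0/monicXnsubC.
  rewrite rmorphB /= map_polyXn map_polyC /= /root !hornerE /= -c2.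
  by rewrite subrr.
- by exists (n%:R / p%:R); rewrite -c2 sqrtr_sqr gtr0_norm.
Qed.

(** The multiples of [sqrt 2] by positive rational numbers are admissible, and
    already dense. *)
Lemma light_speed_dense (R : realType) :
  [set c : R | 0 < c] `<=` closure [set c | admissible_light_speed c].
Proof.
move=> c /= c0 B /nbhs_ballP[e /= e0 eB].
pose t := Num.sqrt 2 : R; have t0 : 0 < t by rewrite sqrtr_gt0.
have t2 : t ^+ 2 = 2 by rewrite sqr_sqrtr.
have t_irr : irrational t.
  (* 3^2 = 4 * 2 + 1 *)
  apply: (@triple_irrational _ _ 3 4 2) => //; split=> //.
  by rewrite t2 -natrM.
have [|q /[!in_itv]/= /andP[ql qu]] := @rat_in_itvoo _ (c / t) ((c + e) / t).
  by rewrite ltr_pM2r ?invr_gt0 //; lra.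
have q0 : 0 < ratr q :> R by apply: lt_trans ql; rewrite divr_gt0.
exists (t * ratr q); split.
  apply/light_speedP; split; first exact: mulr_gt0.
  apply: (@irrational_sqrt_triple _ _ (2 * q ^+ 2)); first exact: mulr_gt0.
    move=> [r _ rE]; apply: t_irr; exists (r / q) => //.
    by rewrite fmorph_div /= rE mulfK ?gt_eqF.
  rewrite rmorphM rmorphXn /= ratr_nat -t2 -exprMn sqrtr_sqr gtr0_norm //.
  exact: mulr_gt0.
apply: eB; rewrite /ball /=.
move: ql qu; rewrite ltr_pdivrMr // ltr_pdivlMr // mulrC => ql qu.
by rewrite ltr_norml; apply/andP; split; lra.
Qed.

(** * Relative speeds *)

Lemma relative_speedP (R : realType) (V : R) : 0 < V ->
  admissible_relative_speed V <->
  exists m n : nat,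
    [/\ (0 < n)%N, (2 <= m)%N, coprime m n, V = n%:R / m%:R
      & (m%:R ^+ 2 - 1) / n%:R \is a @Num.int R].
Proof.
move=> V0; split=> [[c /admissibleP[c0 [m [n [p [t VE]]]]]]|[m [n [n0 m2 _ VE pint]]]].
  have [m0 n0 p0] := triple_gt0 t; have [m1 e cpn] := t.
  exists m, n; split=> //.
  - exact: triple_coprime t.
  - by rewrite -VE gtr0_norm.
  - rewrite (triple_norm t) addrK mulrAC divff ?mul1r ?rpred_nat //.
    by rewrite pnatr_eq0; lia.
have n0R : 0 < n%:R :> R by rewrite ltr0n.
have m1R : 1 < m%:R :> R by rewrite ltr1n.
have p0 : 0 < (m%:R ^+ 2 - 1) / n%:R :> R.
  by rewrite divr_gt0 // subr_gt0 exprn_egt1.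
have /natrP[p pE] : (m%:R ^+ 2 - 1) / n%:R \is a @Num.nat R.
  by rewrite natrEint pint ltW.
have p0R : 0 < p%:R :> R by rewrite -pE.
exists (Num.sqrt (n%:R / p%:R)); apply/admissibleP; split.
  by rewrite sqrtr_gt0 divr_gt0.
exists m, n, p; split; last by rewrite VE gtr0_norm // -VE.
split=> //; last by rewrite sqr_sqrtr ?divr_ge0 // divfK // gt_eqF.
apply/eqP; rewrite -(eqr_nat R) natrD natrM natrX -pE; apply/eqP.
by field; rewrite gt_eqF.
Qed.

Lemma reduced_fraction_inj (R : realType) (m n m' n' : nat) :
  (0 < m)%N -> (0 < m')%N -> coprime m n -> coprime m' n' ->
  n%:R / m%:R = n'%:R / m'%:R :> R -> m = m' /\ n = n'.
Proof.
move=> m0 m0' co co' /eqP.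
rewrite eqr_div ?pnatr_eq0 -?lt0n // -!natrM eqr_nat => /eqP e.
have mm : m = m'.
  apply/eqP; rewrite eqn_dvd; apply/andP; split.
    by rewrite -(Gauss_dvdr _ co) e dvdn_mull.
  by rewrite -(Gauss_dvdr _ co') -e dvdn_mull.
split=> //; apply/eqP; rewrite -(eqn_pmul2r m0); apply/eqP; rewrite -e mm //.
Qed.

(** The reduced fraction [n / m] is determined by [V], and [m], [n] determine
    [p = (m^2 - 1) / n] and [c^2 = n / p]. *)
Lemma admissible_uniq (R : realType) (V c c' : R) :
  admissible V c -> admissible V c' -> c = c'.
Proof.
move=> /admissibleP[c0 [m [n [p [t VE]]]]] /admissibleP[c0' [m' [n' [p' [t' VE']]]]].
have [m0 n0 p0] := triple_gt0 t.
have [m0' _ _] := triple_gt0 t'.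
have [|mm nn] := @reduced_fraction_inj R m n m' n' m0 m0'
  (triple_coprime t) (triple_coprime t').
  by rewrite -VE -VE'.
subst m' n'; case: t t' => m1 e cpn [_ e' cpn'].
have pp : p = p' by nia.
subst p'; apply: sqr_inj; rewrite ?(ltW c0) ?(ltW c0') //.
by apply: (@mulIf _ p%:R); [rewrite pnatr_eq0; lia | rewrite /= cpn cpn'].
Qed.

Lemma light_speed_ofE (R : realType) (V c : R) :
  admissible V c -> light_speed_of V = c.
Proof.
move=> a; apply: xget_unique => [|c' [_ a']]; last exact: admissible_uniq a' a.
by split=> //; split; [have [/andP[? ?] _] := a; lra | exists V].
Qed.

(** * The spectrum of a light speed *)

Definition is_lorentz_factor (R : realType) (c : R) (m : nat) : Prop :=
  exists n p, lorentz_triple c m n p.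

(** The velocity with Lorentz factor [m], from [1 / m^2 = 1 - V^2 / c^2]. *)
Definition speed (R : realType) (c : R) (m : nat) : R :=
  c * Num.sqrt (1 - m%:R ^- 2).

Lemma speed_sqr (R : realType) (c : R) (m : nat) : (0 < m)%N ->
  speed c m ^+ 2 = c ^+ 2 - c ^+ 2 / m%:R ^+ 2.
Proof.
move=> m0; rewrite exprMn sqr_sqrtr; first by ring.
by rewrite subr_ge0 invf_le1 ?exprn_gt0 ?exprn_ege1 ?ltr0n ?ler1n.
Qed.

Lemma triple_speed (R : realType) (c : R) m n p : 0 < c ->
  lorentz_triple c m n p -> n%:R / m%:R = speed c m.
Proof.
move=> c0 t; have [m0 n0 p0] := triple_gt0 t; have [m1 e cpn] := t.
have mR : m%:R != 0 :> R by rewrite pnatr_eq0; lia.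
have pR : p%:R != 0 :> R by rewrite pnatr_eq0; lia.
apply: sqr_inj; rewrite ?divr_ge0 ?mulr_ge0 ?sqrtr_ge0 ?(ltW c0) //.
rewrite speed_sqr //.
have -> : c ^+ 2 - c ^+ 2 / m%:R ^+ 2 = c ^+ 2 * (m%:R ^+ 2 - 1) / m%:R ^+ 2.
  by field.
have -> : m%:R ^+ 2 - 1 = n%:R * p%:R :> R by rewrite (triple_norm t) addrK.
by rewrite expr_div_n -cpn; field.
Qed.

Lemma spectrumP (R : realType) (c V : R) : 0 < c ->
  spectrum c V <-> exists2 m, is_lorentz_factor c m & `|V| = speed c m.
Proof.
move=> c0; rewrite /spectrum /=; split.
  move=> /admissibleP[_ [m [n [p [t ->]]]]]; exists m; last exact: triple_speed t.
  by exists n, p.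
move=> [m [n [p t]] VE]; apply/admissibleP; split=> //; exists m, n, p; split=> //.
by rewrite (triple_speed c0 t).
Qed.

Lemma speed_gt0 (R : realType) (c : R) m : 0 < c -> is_lorentz_factor c m ->
  0 < speed c m.
Proof.
move=> c0 [n [p t]]; have [m0 n0 p0] := triple_gt0 t.
by rewrite -(triple_speed c0 t) divr_gt0 ?ltr0n.
Qed.

Lemma speed_ge0 (R : realType) (c : R) m : 0 < c -> 0 <= speed c m.
Proof. by move=> c0; rewrite mulr_ge0 ?sqrtr_ge0 // ltW. Qed.

Lemma speed_lt (R : realType) (c : R) (m m' : nat) : 0 < c -> (0 < m)%N ->
  (m < m')%N -> speed c m < speed c m'.
Proof.
move=> c0 m0 mm'; rewrite -(@ltr_pXn2r _ 2) ?nnegrE ?speed_ge0 //.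
rewrite !speed_sqr //; last by lia.
rewrite ltrD2l ltrN2 ltr_pM2l ?exprn_gt0 // ltf_pV2 ?posrE ?exprn_gt0 ?ltr0n //; last by lia.
by rewrite ltr_pXn2r ?nnegrE // ltr_nat.
Qed.

(** Squaring the matrix of a Lorentz map composes the map with itself, and turns
    the triple [(m, n, p)] into [(2 m^2 - 1, 2 m n, 2 m p)]. *)
Lemma lorentz_factor_unbounded (R : realType) (c : R) (N : nat) :
  admissible_light_speed c -> exists2 m, (N < m)%N & is_lorentz_factor c m.
Proof.
move=> /light_speedP[c0 [m0 [n0 [p0 t0]]]].
elim: N => [|N [m Nm [n [p [m1 e cpn]]]]].
  by exists m0; [case: t0; lia | exists n0, p0].
exists (2 * m ^ 2 - 1)%N; first by nia.
exists (2 * m * n)%N, (2 * m * p)%N; split; first nia.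
  have -> : (2 * m * n * (2 * m * p) = 4 * m ^ 2 * (n * p))%N by ring.
  have -> : (2 * m ^ 2 - 1 = 2 * (n * p) + 1)%N by rewrite e; lia.
  by rewrite e; ring.
by rewrite !natrM -cpn; ring.
Qed.

Lemma increasing_enumeration (P : nat -> Prop) :
  (forall N, exists2 m, (N < m)%N & P m) ->
  exists e : nat -> nat, (forall i j, (i < j)%N -> (e i < e j)%N) /\
    forall m, P m <-> exists i, e i = m.
Proof.
move=> unb.
have nextP N : exists m, (N <= m)%N && `[< P m >].
  by have [m Nm Pm] := unb N; exists m; rewrite ltnW //; apply/asboolP.
pose next N := ex_minn (nextP N).
have next_ge N : (N <= next N)%N by rewrite /next; case: ex_minnP => m /andP[].
have nextPP N : P (next N).
  by rewrite /next; case: ex_minnP => m /andP[_ /asboolP].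
have next_min N m : (N <= m)%N -> P m -> (next N <= m)%N.
  by move=> Nm /asboolP Pm; rewrite /next; case: ex_minnP => ? _; apply; rewrite Nm.
pose e i := iter i (fun m => next m.+1) (next 0).
have eS i : (e i < e i.+1)%N by exact: next_ge.
exists e; split=> [i j|m]; first exact: (homo_ltn ltn_trans).
split=> [Pm|[i <-]]; last by case: i => [|i]; exact: nextPP.
have [i im] : exists i, (m <= e i)%N.
  by exists m; elim: m {Pm} => // m IH; exact: leq_ltn_trans IH (eS m).
elim: i im => [|i IH] im.
  by exists 0%N; apply/eqP; rewrite eqn_leq im next_min.
have [/IH //|lt_im] := leqP m (e i).
by exists i.+1; apply/eqP; rewrite eqn_leq im next_min.
Qed.

(** Since [c^2 - V^2 = c^2 / m^2], the points of the spectrum with [c^2 - V^2]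
    bounded away from 0 have bounded [m], so they are finitely many: nothing
    accumulates away from [c] and [- c].  Unbounded [m] makes these two points
    limits. *)
Lemma spectrum_limit_point (R : realType) (c : R) : admissible_light_speed c ->
  limit_point (spectrum c) = [set - c; c].
Proof.
move=> ac; have [c0 _] := ac; apply/seteqP; split=> [x|x].
  move=> /limit_point_infinite_setP lim; apply: contrapT => xc.
  have xc2 : 0 < `|c ^+ 2 - x ^+ 2|.
    rewrite normr_gt0 subr_eq0 eq_sym eqf_sqr; apply/negP => /orP[] /eqP h.
      by apply: xc; right.
    by apply: xc; left.
  set d := `|_| in xc2.
  have cont : {for x, continuous (fun y : R => c ^+ 2 - y ^+ 2)}.
    by apply: cvgB; [exact: cvg_cst | exact: exprn_continuous].
  have d2 : 0 < d / 2 by rewrite divr_gt0.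
  have /lim : nbhs x [set y : R | d / 2 < `|c ^+ 2 - y ^+ 2|].
    have /cvgrPdist_lt /(_ _ d2) := cont; apply: filterS => y /=.
    have := ler_normD (c ^+ 2 - x ^+ 2 - (c ^+ 2 - y ^+ 2)) (c ^+ 2 - y ^+ 2).
    by rewrite subrK -/d; lra.
  apply; pose N := Num.bound (c ^+ 2 / (d / 2)).
  apply: (sub_finite_set (B := speed c @` `I_N `|` (fun m => - speed c m) @` `I_N)).
    move=> V [/= dV /(spectrumP _ c0)[m [n [p t]] VE]].
    have [m0 _ _] := triple_gt0 t.
    have mN : (m < N)%N.
      have m0R : 0 < m%:R :> R by rewrite ltr0n.
      move: dV; rewrite -(real_normK (num_real V)) VE speed_sqr // subKr.
      rewrite gtr0_norm ?divr_gt0 ?exprn_gt0 // ltr_pdivlMr ?exprn_gt0 // mulrC.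
      rewrite -ltr_pdivlMr // => mc.
      have x0 : 0 <= c ^+ 2 / (d / 2) by rewrite divr_ge0 ?ltW ?exprn_gt0.
      rewrite -(ltr_nat R); apply: lt_trans (archi_boundP x0).
      by apply: le_lt_trans mc; rewrite -natrX ler_nat; nia.
    move: VE; case: (ger0P V) => _ VE; [left|right]; exists m => //=.
    by rewrite -VE opprK.
  by rewrite finite_setU; split; apply: finite_image; exact: finite_II.
have limc : limit_point (spectrum c) c.
  move=> U /nbhs_ballP[e /= e0 eU].
  have [m Nm mf] := lorentz_factor_unbounded (Num.bound (c / e)) ac.
  have [n [p t]] := mf; have [m0 _ _] := triple_gt0 t.
  have s0 := speed_gt0 c0 mf.
  have m0R : 0 < m%:R :> R by rewrite ltr0n.
  have gap : speed c m < c.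
    rewrite -(@ltr_pXn2r _ 2) ?nnegrE ?ltW // speed_sqr // ltrBlDr ltrDl.
    by rewrite divr_gt0 ?exprn_gt0.
  exists (speed c m); split; first by rewrite lt_eqF.
    by apply/(spectrumP _ c0); exists m => //; rewrite gtr0_norm.
  apply: eU; rewrite /ball /= gtr0_norm ?subr_gt0 //.
  have me : c / m%:R < e.
    rewrite ltr_pdivrMr // mulrC -ltr_pdivrMr //.
    apply: lt_trans (archi_boundP _) _; first by rewrite divr_ge0 ?ltW.
    by rewrite ltr_nat.
  have m1R : 1 <= m%:R :> R by rewrite ler1n.
  have cm : c / m%:R ^+ 2 <= c / m%:R.
    rewrite ler_pM2l // lef_pV2 ?posrE ?exprn_gt0 //.
    by rewrite expr2 ler_peMl // ltW.
  have : (c - speed c m) * c <= c / m%:R ^+ 2 * c.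
    have -> : c / m%:R ^+ 2 * c = c ^+ 2 - speed c m ^+ 2.
      by rewrite speed_sqr // subKr; field; rewrite gt_eqF.
    have : 0 <= speed c m * (c - speed c m).
      by rewrite mulr_ge0 ?subr_ge0 // ltW.
    by rewrite mulrBr mulrBl !expr2 => ?; lra.
  by rewrite ler_pM2r //; lra.
move=> [->|->] //= U /nbhs_ballP[e /= e0 eU].
have [V [Vc sV VU]] := limc _ (nbhsx_ballx c e e0).
exists (- V); split; first by rewrite eqr_opp.
  exact/admissible_neg.
by apply: eU; move: VU; rewrite /ball /= -opprD normrN.
Qed.

Lemma spectrum_enumeration (R : realType) (c : R) : admissible_light_speed c ->
  exists V : nat -> R,
    [/\ forall i, 0 < V i,
        forall i j, (i < j)%N -> V i < V j,
        spectrum c = [set v | exists i, v = V i \/ v = - V i]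
      & forall i, c = light_speed_of (V i)].
Proof.
move=> ac; have [c0 _] := ac.
have [e [e_incr eP]] := increasing_enumeration
  (fun N => lorentz_factor_unbounded N ac).
have mf i : is_lorentz_factor c (e i) by apply/eP; exists i.
have V0 i : 0 < speed c (e i) by exact: speed_gt0.
have Vs i : spectrum c (speed c (e i)).
  by apply/(spectrumP _ c0); exists (e i); rewrite ?gtr0_norm.
exists (fun i => speed c (e i)); split=> // [i j ij| |i].
- have [n [p t]] := mf i; have [m0 _ _] := triple_gt0 t.
  by apply: speed_lt => //; exact: e_incr.
- apply/seteqP; split=> [V /(spectrumP _ c0)[m /eP[i <-]] VE|V [i [->|->]]] //=.
    exists i; rewrite -VE; case: (ger0P V) => _; [left|right] => //.
    by rewrite opprK.
  exact/admissible_neg/Vs.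
- by rewrite (light_speed_ofE (Vs i)).
Qed.

Lemma spectrum_countable (R : realType) (c : R) : admissible_light_speed c ->
  countable (spectrum c).
Proof.
move=> /spectrum_enumeration[V [_ _ -> _]].
apply: (sub_countable (B := range (fun ib : nat * bool => (-1) ^+ ib.2 * V ib.1))).
  apply: subset_card_le => v [i [->|->]].
    by exists (i, false) => //=; rewrite mul1r.
  by exists (i, true) => //=; rewrite mulN1r.
exact: sub_countable (card_image_le _ _) (countableP _).
Qed.

Theorem theorem2 (R : realType) :
  (forall c : R, 0 < c ->
     (admissible_light_speed c <->
      [/\ irrational c, algebraicOver (ratr : rat -> R) c
        & exists q : rat, c = Num.sqrt (ratr q)]))
  /\ ([set c : R | admissible_light_speed c] `<=` [set c | 0 < c] /\
      [set c : R | 0 < c] `<=` closure [set c | admissible_light_speed c])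
  /\ (forall V : R, 0 < V ->
        (admissible_relative_speed V <->
         exists m n : nat,
           [/\ (0 < n)%N, (2 <= m)%N, coprime m n, V = n%:R / m%:R
             & (m%:R ^+ 2 - 1) / n%:R \is a @Num.int R]))
  /\ (forall V : R, admissible_relative_speed V ->
        exists! c : R, admissible_light_speed c /\ admissible V c)
  /\ (forall c : R, admissible_light_speed c ->
        [/\ countable (spectrum c), infinite_set (spectrum c)
          & exists V : nat -> R,
              [/\ forall i, 0 < V i,
                  forall i j, (i < j)%N -> V i < V j,
                  spectrum c = [set v | exists i, v = V i \/ v = - V i]
                & forall i, c = light_speed_of (V i)]])
  /\ (forall c : R, admissible_light_speed c ->
        limit_point (spectrum c) = [set - c; c])
  /\ (forall c c' : R, admissible_light_speed c -> admissible_light_speed c' ->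
        c <> c' -> spectrum c `&` spectrum c' = set0).
Proof.
split; first exact: light_speed_irrationalP.
split; first by split=> [c []|] //; exact: light_speed_dense.
split; first exact: relative_speedP.
split.
  move=> V [c a]; exists c; split=> [|c' [_ a']]; last exact: admissible_uniq a a'.
  by split=> //; split; [have [/andP[? ?] _] := a; lra | exists V].
split.
  move=> c ac; split; [exact: spectrum_countable | | exact: spectrum_enumeration].
  have : limit_point (spectrum c) c by rewrite spectrum_limit_point //; right.
  by move=> /limit_point_infinite_setP /(_ _ filterT); rewrite setTI.
split; first exact: spectrum_limit_point.
move=> c c' _ _ cc'; apply/seteqP; split=> // V [a a'].
by apply: cc'; exact: admissible_uniq a a'.
Qed.
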